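(* The Wasserstein mean is the multivariate Lie-Trotter mean, that is: let $\omega = (w_1, \dots, w_n) \in \Delta_n$, let $\epsilon > 0$, and let $\gamma_j : (-\epsilon, \epsilon) \to \mathbb{P}_m$, $j = 1, \dots, n$, be differentiable curves with $\gamma_j(0) = I$ for all $j = 1, \dots, n$. Then $$\lim_{s \to 0} \Omega(\omega; \gamma_1(s), \gamma_2(s), \ldots, \gamma_n(s))^{1/s} = \exp\left[ \sum_{j=1}^{n} w_j \gamma_j'(0) \right],$$ where $\Omega$ denotes the Wasserstein mean.
   Context: $\mathbb{P}_m$ is the set of all $m \times m$ complex positive definite Hermitian matrices, an open subset of the real vector space of $m\times m$ Hermitian matrices; $I$ is the identity matrix. For $A \in \mathbb{P}_m$ and $r \in \mathbb{R}$, $A^r$ is defined by the functional calculus, and $\exp$ is the matrix exponential. $\Delta_n$ is the set of positive probability vectors $\omega = (w_1, \dots, w_n) \in \mathbb{R}^n$, i.e. $w_j > 0$ for all $j$ and $\sum_{j=1}^n w_j = 1$. The Wasserstein metric on $\mathbb{P}_m$ is $$d(A,B) = \left[ \operatorname{tr}\left( \frac{A+B}{2} \right) - \operatorname{tr} (A^{1/2} B A^{1/2})^{1/2} \right]^{1/2}.$$ The Wasserstein mean is the unique minimizer $$\Omega(\omega; A_1, \dots, A_n) = \underset{X \in \mathbb{P}_m}{\arg\min} \sum_{j=1}^n w_j d^2(X, A_j);$$ it is known to exist, to be unique, and to coincide with the unique solution $X \in \mathbb{P}_m$ of $X = \sum_{j=1}^n w_j (X^{1/2} A_j X^{1/2})^{1/2}$,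 equivalently of $I = \sum_{j=1}^n w_j (A_j \# X^{-1})$, where $A \# B = A^{1/2}(A^{-1/2} B A^{-1/2})^{1/2} A^{1/2}$. *)

(* Defs.v *)
From HB Require Import structures.
From mathcomp Require Import all_boot all_order all_algebra.
From mathcomp Require Import complex.
From mathcomp Require Import all_classical all_reals all_analysis.

Set Implicit Arguments.
Unset Strict Implicit.
Unset Printing Implicit Defensive.

Import Order.TTheory GRing.Theory Num.Theory.
Import numFieldNormedType.Exports.

Local Open Scope classical_set_scope.
Local Open Scope ring_scope.
Local Open Scope complex_scope.
Local Open Scope sesquilinear_scope.

(* The library topologizes abstract numFieldTypes only; this transports that
   (modulus) topology to the concrete type [R[i]], and hence to matrices. *)
HB.instance Definition _ (R : realType) :=
  NormedModule.copy R[i] (R[i] : numClosedFieldType)^o.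

Section PositiveDefinite.
Context {R : realType} {m : nat}.
Implicit Types (A B : 'M[R[i]]_m).

(* [0 < z] in [R[i]] means that [z] is real and positive. *)
Definition posdefmx : set 'M[R[i]]_m :=
  [set A | A \is hermsymmx /\
           forall v : 'cV[R[i]]_m, v != 0 -> 0 < (v^t* *m A *m v) 0 0].

(* [spectral_diag A] is real when [A] is Hermitian, so [Re] loses nothing. *)
Definition funcalcmx (f : R -> R) A : 'M[R[i]]_m :=
  invmx (spectralmx A)
    *m diag_mx (map_mx (fun z => (f (complex.Re z))%:C) (spectral_diag A))
    *m spectralmx A.

Definition powmx A (r : R) : 'M[R[i]]_m := funcalcmx (fun x => x `^ r) A.

Definition expmx A : 'M[R[i]]_m :=
  lim (series (fun k => (k`!%:R)^-1 *: A ^+ k) @ \oo).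

(* The quantity under the outer square root is real on positive definite
   matrices; [Re] only moves it from [R[i]] to [R]. *)
Definition wasserstein_dist A B : R :=
  Num.sqrt (complex.Re
    (\tr (2^-1 *: (A + B)) - \tr (powmx (powmx A 2^-1 *m B *m powmx A 2^-1) 2^-1))).

End PositiveDefinite.

Section WassersteinMean.
Context {R : realType} {m n : nat}.

Definition pos_prob_vectors : set ('I_n -> R) :=
  [set w | (forall j, 0 < w j) /\ \sum_(j < n) w j = 1].

Definition wasserstein_cost (w : 'I_n -> R) (A : 'I_n -> 'M[R[i]]_m)
    (X : 'M[R[i]]_m) : R :=
  \sum_(j < n) w j * wasserstein_dist X (A j) ^+ 2.

(* The set below is in fact a singleton when [w] is a positive probability
   vector and every [A j] is positive definite; [get] returns its element (and
   an unspecified matrix should the set be empty). *)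
Definition wasserstein_mean (w : 'I_n -> R) (A : 'I_n -> 'M[R[i]]_m) :
    'M[R[i]]_m :=
  get [set X | posdefmx X /\
    forall Y, posdefmx Y -> wasserstein_cost w A X <= wasserstein_cost w A Y].

End WassersteinMean.

(* ['M[R[i]]_m] is a normed module over [R[i]] and not over [R], so [derive1]
   does not apply to curves of a real parameter. *)
Section Curves.
Context {R : realType} {m : nat}.

Definition curve_quotient (g : R -> 'M[R[i]]_m) (s h : R) : 'M[R[i]]_m :=
  h^-1%:C *: (g (h + s) - g s).

Definition curve_derivable (g : R -> 'M[R[i]]_m) (s : R) : Prop :=
  cvg (curve_quotient g s @ 0^').

Definition curve_derive (g : R -> 'M[R[i]]_m) (s : R) : 'M[R[i]]_m :=
  lim (curve_quotient g s @ 0^').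

End Curves.

(* Main.v *)
(* Fidelity is variational: for positive definite [A], [B], [D],
   [tr (A^1/2 B A^1/2)^1/2 <= (tr (A D) + tr (B D^-1)) / 2], with equality iff
   [D A D = B].  Hence, as soon as positive definite [X] and [D_j] satisfy
   [D_j X D_j = A_j] and [\sum_j w_j D_j = 1], the cost is minimal at [X] and
   only there.  Writing [X = 1 + x], [D_j = 1 + c_j], [A_j = 1 + a_j], this
   system is [x + 2 c_j + quad x c_j = a_j], [\sum_j w_j c_j = 0] with [quad] of
   degree at least two, so for small [a_j] it is solved by Picard iteration and
   [x = \sum_j w_j a_j + O(max |a_j|^2)].  With [a_j = s gamma_j'(0) + o(s)],
   [ln X / s] tends to [\sum_j w_j gamma_j'(0)], and [X^(1/s) = exp (ln X / s)]. *)
Require Import Defs.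
From HB Require Import structures.
From mathcomp Require Import all_boot all_order all_algebra.
From mathcomp Require Import complex ring lra.
From mathcomp Require Import all_classical all_reals all_analysis.

Import Order.TTheory GRing.Theory Num.Theory.
Import numFieldNormedType.Exports.

Local Open Scope classical_set_scope.
Local Open Scope ring_scope.
Local Open Scope complex_scope.
Local Open Scope sesquilinear_scope.

(** Expanding the mean directly would call for an existence theory of minimizers and for derivatives
    of matrix square roots. A certificate avoids both: exhibiting [X] together with the [D_j]
    already settles which matrix [get] returns. The [D_j] are the geometric means [A_j # X^-1], so
    that [\sum_j w_j D_j = 1] is the mean equation; with the [D_j] kept as unknowns the system is
    polynomial. The iteration preserves Hermitian symmetry, and a small Hermitian perturbation of
    the identity is positive definite, so its limit is an admissible certificate. An eigenbasis need
    not vary continuously with its matrix. Estimates on functions of a matrix are therefore uniform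
    over all unitary changes of basis, which is the origin of the powers of [m * m]. The exponent
    [1/s] is unbounded as [s] tends to 0; on logarithms it is only a scalar factor, and the
    quadratic error of the expansion absorbs it. *)

Section EntrywiseNorm.
Set Implicit Arguments.
Unset Strict Implicit.
Context {R : realType}.
Local Notation C := R[i].

(** * A real-valued matrix norm and convergence of matrices *)

Lemma normc_ge0 (z : C) : 0 <= Normc.normc z.
Proof. by rewrite -ler0c (normr_ge0 z). Qed.

Lemma normc_conj (z : C) : Normc.normc z^* = Normc.normc z.
Proof. by apply: complexI; exact: norm_conjC. Qed.

Lemma normc_real (r : R) : Normc.normc (r%:C : C) = `|r|.
Proof. by rewrite /= expr0n addr0 sqrtr_sqr. Qed.

Lemma normc_Re (z : C) : `|complex.Re z| <= Normc.normc z.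
Proof. by have := normc_ge_Re z; rewrite lecR. Qed.

(** Real valued, submultiplicative and invariant under the adjoint, but not normalized: the identity
    has norm [m]. *)
Definition nrm {m n} (A : 'M[C]_(m, n)) : R :=
  \sum_i \sum_j Normc.normc (A i j).

Section Rectangular.
Context {m n : nat}.
Implicit Types A B : 'M[C]_(m, n).

Lemma nrm_ge0 A : 0 <= nrm A.
Proof. by apply: sumr_ge0 => i _; apply: sumr_ge0 => j _; apply: normc_ge0. Qed.

Lemma nrm0 : nrm (0 : 'M[C]_(m, n)) = 0.
Proof. by apply: big1 => i _; apply: big1 => j _; rewrite mxE Normc.normc0. Qed.

Lemma le_normc_nrm A i j : Normc.normc (A i j) <= nrm A.
Proof.
rewrite /nrm (bigD1 i) //= (bigD1 j) //= -addrA lerDl addr_ge0 //.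
  by apply: sumr_ge0 => k _; apply: normc_ge0.
by apply: sumr_ge0 => k _; apply: sumr_ge0 => l _; apply: normc_ge0.
Qed.

Lemma nrm_eq0 A : nrm A = 0 -> A = 0.
Proof.
move=> A0; apply/matrixP => i j; rewrite mxE; apply: Normc.eq0_normc.
by apply/eqP; rewrite eq_le normc_ge0 andbT -A0 le_normc_nrm.
Qed.

Lemma nrmD A B : nrm (A + B) <= nrm A + nrm B.
Proof.
rewrite /nrm -big_split /=; apply: ler_sum => i _.
rewrite -big_split /=; apply: ler_sum => j _.
by rewrite mxE; apply: le_normcD.
Qed.

Lemma nrmD_le A B a b : nrm A <= a -> nrm B <= b -> nrm (A + B) <= a + b.
Proof. by move=> ha hb; apply: le_trans (nrmD _ _) _; apply: lerD. Qed.

Lemma nrmN A : nrm (- A) = nrm A.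
Proof.
by apply: eq_bigr => i _; apply: eq_bigr => j _; rewrite mxE; apply: normcN.
Qed.

Lemma nrm_distC A B : nrm (A - B) = nrm (B - A).
Proof. by rewrite -nrmN opprB. Qed.

Lemma nrmB A B : nrm (A - B) <= nrm A + nrm B.
Proof. by rewrite -(nrmN B); apply: nrmD. Qed.

Lemma nrm_dist_tri B A D : nrm (A - D) <= nrm (A - B) + nrm (B - D).
Proof. by rewrite -[A - D](subrKA B); apply: nrmD. Qed.

Lemma nrmZ (z : C) A : nrm (z *: A) = Normc.normc z * nrm A.
Proof.
rewrite /nrm mulr_sumr; apply: eq_bigr => i _.
by rewrite mulr_sumr; apply: eq_bigr => j _; rewrite mxE Normc.normcM.
Qed.

Lemma nrmZr (r : R) A : nrm (r%:C *: A) = `|r| * nrm A.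
Proof. by rewrite nrmZ normc_real. Qed.

Lemma nrm_sum (I : Type) (r : seq I) (P : pred I) (F : I -> 'M[C]_(m, n)) :
  nrm (\sum_(i <- r | P i) F i) <= \sum_(i <- r | P i) nrm (F i).
Proof.
elim/big_rec2: _ => [|i x A _ h]; first by rewrite nrm0.
by apply: le_trans (nrmD _ _) _; rewrite lerD2l.
Qed.

End Rectangular.

Lemma nrm_trmxC {m n} (A : 'M[C]_(m, n)) : nrm (A^t*) = nrm A.
Proof.
rewrite /nrm exchange_big /=; apply: eq_bigr => i _; apply: eq_bigr => j _.
by rewrite !mxE; apply: normc_conj.
Qed.

Lemma nrmM {m n p} (A : 'M[C]_(m, n)) (B : 'M[C]_(n, p)) :
  nrm (A *m B) <= nrm A * nrm B.
Proof.
apply: (@le_trans _ _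
  (\sum_i \sum_j \sum_k Normc.normc (A i k) * Normc.normc (B k j))).
  apply: ler_sum => i _; apply: ler_sum => j _; rewrite mxE.
  elim/big_rec2: _ => [|k x y _ h]; first by rewrite Normc.normc0.
  by apply: le_trans (le_normcD _ _) _; rewrite Normc.normcM lerD2l.
rewrite /nrm mulr_suml; apply: ler_sum => i _.
rewrite exchange_big /= mulr_suml; apply: ler_sum => k _.
rewrite -mulr_sumr ler_wpM2l ?normc_ge0 // (bigD1 k) //= lerDl.
by apply: sumr_ge0 => l _; apply: sumr_ge0 => j _; apply: normc_ge0.
Qed.

Lemma nrm_mul_le {m n p} (A : 'M[C]_(m, n)) (B : 'M[C]_(n, p)) a b :
  nrm A <= a -> nrm B <= b -> nrm (A *m B) <= a * b.
Proof. by move=> ha hb; apply: le_trans (nrmM _ _) _; rewrite ler_pM ?nrm_ge0. Qed.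

Lemma cvg_mx_entries {T : Type} {m n} (F : set_system T) {FF : Filter F}
    (f : T -> 'M[C]_(m, n)) (L : 'M[C]_(m, n)) :
  (forall i j (e : R), 0 < e ->
    \forall x \near F, Normc.normc ((f x - L) i j) < e) ->
  f @ F --> L.
Proof.
move=> fL; apply/cvg_ballP => e e0.
(* A positive element of [R[i]] is real, so the balls of the topology have real radii. *)
have /complex_realP[r er] := gtr0_real e0.
have r0 : 0 < r by rewrite er ltcR in e0.
have : \forall x \near F, forall ij : 'I_m * 'I_n,
    Normc.normc ((f x - L) ij.1 ij.2) < r.
  by apply: filter_forall => ij; apply: fL.
apply: filterS => x Lx; split=> // i j.
rewrite /ball /= distrC er.
have := Lx (i, j); rewrite /= !mxE -ltcR; exact.
Qed.

Lemma cvg_nrmP {T : Type} {m n} (F : set_system T) {FF : Filter F}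
    (f : T -> 'M[C]_(m, n)) (L : 'M[C]_(m, n)) :
  f @ F --> L <->
  (forall e : R, 0 < e -> \forall x \near F, nrm (f x - L) < e).
Proof.
split=> [fL e e0|fL].
  (* The successor keeps the denominator positive for empty matrices and makes the final bound
     strict. *)
  pose d : R := e / (m * n).+1%:R.
  have d0 : 0 < d by rewrite divr_gt0.
  have dC0 : (0 : C) < d%:C by rewrite ltcR.
  move/cvg_ballP : fL => /(_ _ dC0); apply: filterS => x [_ Lx].
  apply: (@le_lt_trans _ _ (\sum_(i < m) \sum_(j < n) d)).
    apply: ler_sum => i _; apply: ler_sum => j _.
    have := Lx i j; rewrite /ball /= distrC !mxE => h.
    by rewrite -lecR; apply: ltW.
  rewrite !sumr_const !card_ord -mulrnA -mulr_natr /d mulrAC -mulrA.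
  rewrite gtr_pMr // ltr_pdivrMr ?ltr0n // mul1r ltr_nat mulnC //.
apply: cvg_mx_entries => i j e e0; apply: filterS (fL _ e0) => x.
by apply: le_lt_trans; apply: le_normc_nrm.
Qed.

Lemma cvg_mx_unique {T : Type} {m n} (F : set_system T) {FF : ProperFilter F}
    (f : T -> 'M[C]_(m, n)) (L : 'M[C]_(m, n)) :
  f @ F --> L -> lim (f @ F) = L.
Proof. by move=> fL; apply: (cvg_lim (@norm_hausdorff _ _) fL). Qed.

(** Weierstrass test: completeness is used for real series only, on the real and imaginary parts of
    each entry. *)
Lemma cvg_mx_series {m n} (v : nat -> 'M[C]_(m, n)) (b : nat -> R) :
  (forall k, nrm (v k) <= b k) -> cvgn (series b) ->
  exists L : 'M[C]_(m, n), (series v : nat -> 'M[C]_(m, n)) @ \oo --> L.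
Proof.
move=> vb cb.
have b0 k : 0 <= b k by apply: le_trans (vb k); apply: nrm_ge0.
have cvgu (u : nat -> R) : (forall k, `|u k| <= b k) -> cvgn (series u).
  move=> ub; apply: normed_cvg.
  by apply: (series_le_cvg _ b0 ub cb) => k /=.
have cRe i j : cvgn (series (fun k => complex.Re (v k i j))).
  apply: cvgu => k; apply: le_trans (normc_Re _) _.
  exact: le_trans (le_normc_nrm _ _ _) (vb k).
have cIm i j : cvgn (series (fun k => complex.Im (v k i j))).
  apply: cvgu => k; apply: le_trans (vb k).
  apply: le_trans (le_normc_nrm _ i j).
  have := normc_Re (v k i j * 'i%C).
  by rewrite ReiNIm normrN Normc.normcM /= expr0n expr1n add0r sqrtr1 mulr1.
exists (\matrix_(i, j)
  (limn (series (fun k => complex.Re (v k i j))) +i*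
   limn (series (fun k => complex.Im (v k i j))))).
apply: cvg_mx_entries => i j e e0.
have e20 : 0 < e / 2 by rewrite divr_gt0.
have /cvgrPdist_lt /(_ _ e20) hR := cRe i j.
have /cvgrPdist_lt /(_ _ e20) hI := cIm i j.
apply: filterS2 hR hI => k; rewrite !seriesEnat /= => hR hI.
have -> : (\sum_(0 <= l < k) v l - \matrix_(i, j)
  (limn (series (fun k => complex.Re (v k i j))) +i*
   limn (series (fun k => complex.Im (v k i j))))) i j =
  (\sum_(0 <= l < k) complex.Re (v l i j) -
     limn (series (fun k => complex.Re (v k i j))))%:C +
  'i%C * (\sum_(0 <= l < k) complex.Im (v l i j) -
     limn (series (fun k => complex.Im (v k i j))))%:C.
  rewrite !mxE summxE [LHS]complexE; congr (_%:C + _ * _%:C).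
  - by rewrite raddfB /= raddf_sum.
  - by rewrite raddfB /= raddf_sum.
apply: le_lt_trans (le_normcD _ _) _.
rewrite Normc.normcM !normc_real.
have -> : Normc.normc ('i%C : C) = 1 by rewrite /= expr0n expr1n add0r sqrtr1.
rewrite mul1r (splitr e); apply: ltrD; rewrite distrC //.
Qed.

End EntrywiseNorm.

(** * Positive definite matrices and the variational formula for fidelity *)

Section HermitianPositive.
Set Implicit Arguments.
Unset Strict Implicit.
Context {C : numClosedFieldType}.

Lemma trmxCM {m n p} (A : 'M[C]_(m, n)) (B : 'M[C]_(n, p)) :
  (A *m B)^t* = B^t* *m A^t*.
Proof. by rewrite trmx_mul map_mxM. Qed.

Lemma trmxCD {m n} (A B : 'M[C]_(m, n)) : (A + B)^t* = A^t* + B^t*.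
Proof. by rewrite linearD /= map_mxD. Qed.

Lemma trmxCN {m n} (A : 'M[C]_(m, n)) : (- A)^t* = - A^t*.
Proof. by rewrite linearN /= map_mxN. Qed.

Lemma trmxC1 {m} : (1%:M : 'M[C]_m)^t* = 1%:M.
Proof. by rewrite trmx1 map_mx1. Qed.

Lemma trmxCZ {m n} (r : C) (A : 'M[C]_(m, n)) : (r *: A)^t* = r^*%R *: A^t*.
Proof. by apply/matrixP => i j; rewrite !mxE rmorphM. Qed.

Lemma trmxC_sum {m n} (I : Type) (r : seq I) (P : pred I) (F : I -> 'M[C]_(m, n)) :
  (\sum_(i <- r | P i) F i)^t* = \sum_(i <- r | P i) (F i)^t*.
Proof.
by apply: (big_morph (fun A => A^t*) trmxCD); rewrite trmx0 map_mx0.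
Qed.

Lemma mxtrace_sum {m} (I : Type) (r : seq I) (P : pred I) (F : I -> 'M[C]_m) :
  \tr (\sum_(i <- r | P i) F i) = \sum_(i <- r | P i) \tr (F i).
Proof. exact: raddf_sum. Qed.

Context {m : nat}.
Implicit Types A B D P U : 'M[C]_m.

(* [posdefmx] over an arbitrary [numClosedFieldType]. *)
Definition hpos A :=
  A \is hermsymmx /\ forall v : 'cV[C]_m, v != 0 -> 0 < (v^t* *m A *m v) 0 0.

Lemma hermP A : reflect (A^t* = A) (A \is hermsymmx).
Proof.
by rewrite is_hermitianmxE expr0 scale1r eq_sym; apply: eqP.
Qed.

Lemma hpos_herm A : hpos A -> A^t* = A.
Proof. by case=> /hermP. Qed.

Lemma hpos_unit A : hpos A -> A \in unitmx.
Proof.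
move=> [/hermP hA pA]; rewrite -row_free_unit -kermx_eq0.
apply/negPn/negP => /eqP /eqP K0.
have [i iK] : exists i, row i (kermx A) != 0.
  apply/existsP; apply: contraNT K0; rewrite negb_exists => /forallP K0.
  by apply/eqP/row_matrixP => i; rewrite row0; apply/eqP/negPn/K0.
have uA : row i (kermx A) *m A = 0.
  by apply/sub_kermxP; apply: row_sub.
have v0 : (row i (kermx A))^t* != 0.
  apply: contraNneq iK => /(congr1 (fun x => x^t*)).
  by rewrite trmxCK trmx0 map_mx0 => ->.
by have := pA _ v0; rewrite trmxCK uA mul0mx mxE ltxx.
Qed.

Lemma hpos_congr A P : hpos A -> P \in unitmx -> hpos (P^t* *m A *m P).
Proof.
move=> [/hermP hA pA] uP; split.
  by apply/hermP; rewrite !trmxCM trmxCK hA mulmxA.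
move=> v v0; have Pv0 : P *m v != 0.
  by apply: contraNneq v0 => Pv; rewrite -(mulKmx uP v) Pv mulmx0.
by have := pA _ Pv0; rewrite trmxCM !mulmxA.
Qed.

Lemma hpos_inv A : hpos A -> hpos (invmx A).
Proof.
move=> pA; have uA := hpos_unit pA.
have hi : (invmx A)^t* = invmx A.
  by rewrite trmx_inv map_invmx hpos_herm.
have := hpos_congr pA (etrans (unitmx_inv A) uA).
by rewrite hi mulVmx // mul1mx.
Qed.

Lemma hpos1 : hpos (1%:M : 'M[C]_m).
Proof.
split; first by apply/hermP; rewrite trmxC1.
move=> v v0; rewrite mulmx1 mxE.
have ge0 k : 0 <= (v^t*) 0 k * v k 0 by rewrite !mxE mulrC mul_conjC_ge0.
rewrite lt_def sumr_ge0 // andbT; apply: contraNneq v0 => /psumr_eq0P s0.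
apply/eqP/matrixP => i j; rewrite ord1 mxE.
have /eqP := s0 (fun k _ => ge0 k) i isT.
by rewrite !mxE mulf_eq0 conjC_eq0 orbb => /eqP.
Qed.

Lemma hposD A B : hpos A -> hpos B -> hpos (A + B).
Proof.
move=> [/hermP hA pA] [/hermP hB pB]; split.
  by apply/hermP; rewrite trmxCD hA hB.
by move=> v v0; rewrite mulmxDr mulmxDl mxE addr_gt0 ?pA ?pB.
Qed.

Lemma hpos_entry_gt0 A k : hpos A -> 0 < A k k.
Proof.
move=> [_ pA]; have d0 : (delta_mx k 0 : 'cV[C]_m) != 0.
  apply/eqP => /matrixP/(_ k 0); rewrite !mxE !eqxx => /eqP.
  by rewrite oner_eq0.
have := pA _ d0; rewrite trmx_delta map_delta_mx -mulmxA -colE -rowE.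
by rewrite !mxE.
Qed.

Lemma hpos_diag (d : 'rV[C]_m) : (forall k, 0 < d 0 k) -> hpos (diag_mx d).
Proof.
move=> d0; split.
  apply/hermP; rewrite tr_diag_mx map_diag_mx; congr diag_mx.
  by apply/rowP => k; rewrite mxE; apply/geC0_conj/ltW.
move=> v v0; rewrite mxE.
have E k : (v^t* *m diag_mx d) 0 k * v k 0 = d 0 k * (v k 0 * (v k 0)^*%R).
  by rewrite mul_mx_diag !mxE; ring.
rewrite (eq_bigr _ (fun k _ => E k)).
have ge0 k : 0 <= d 0 k * (v k 0 * (v k 0)^*%R).
  by rewrite mulr_ge0 ?mul_conjC_ge0 // ltW.
rewrite lt_def sumr_ge0 // andbT; apply: contraNneq v0 => /psumr_eq0P s0.
apply/eqP/matrixP => i j; rewrite ord1 mxE.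
have /eqP := s0 (fun k _ => ge0 k) i isT.
by rewrite !mulf_eq0 conjC_eq0 orbb gt_eqF //= => /eqP.
Qed.

Lemma tr_congrE P (Z : 'M[C]_m) :
  \tr (Z^t* *m P *m Z) = \sum_j ((col j Z)^t* *m P *m col j Z) 0 0.
Proof.
apply: eq_bigr => j _; rewrite !mxE; apply: eq_bigr => k _.
by rewrite !mxE; congr (_ * _); apply: eq_bigr => l _; rewrite !mxE.
Qed.

(** The trace is the sum of the quadratic form of [P] over the columns of [Z]. The equality case is
    the source of every uniqueness statement below: of positive square roots, then of the
    minimizer. *)
Lemma tr_congr_ge0 P (Z : 'M[C]_m) : hpos P ->
  0 <= \tr (Z^t* *m P *m Z) ?= iff (Z == 0).
Proof.
move=> [_ pP]; rewrite tr_congrE.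
have ge0 j : 0 <= ((col j Z)^t* *m P *m col j Z) 0 0.
  have [->|/pP /ltW //] := eqVneq (col j Z) 0.
  by rewrite mulmx0 mxE.
split; first exact: sumr_ge0.
rewrite eq_sym; apply/idP/eqP => [/eqP/psumr_eq0P s0|->]; last first.
  by apply/eqP/big1 => j _; rewrite col0 mulmx0 mxE.
apply/matrixP => i j; rewrite mxE.
suff /matrixP/(_ i 0) : col j Z = 0 by rewrite !mxE.
apply/eqP; apply: contraTT isT => /pP.
by rewrite s0 ?ltxx.
Qed.

(* [\tr ((A - B) (A + B) (A - B)) = \tr ((A^2 - B^2) (A - B))] by cyclicity. *)
Lemma hpos_sqr_inj A B : hpos A -> hpos B -> A *m A = B *m B -> A = B.
Proof.
move=> pA pB AB; apply/eqP; rewrite -subr_eq0.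
have [_ <-] := tr_congr_ge0 (A - B) (hposD pA pB).
rewrite eq_sym trmxCD trmxCN (hpos_herm pA) (hpos_herm pB).
have -> : (A - B) *m (A + B) = A *m B - B *m A.
  rewrite mulmxBl !mulmxDr AB opprD [- _ - _]addrC addrA.
  by rewrite [B *m B + _]addrC addrK.
rewrite mulmxBl !mulmxBr opprB.
rewrite !(mxtraceD, raddfN) /=.
rewrite -!mulmxA (mxtrace_mulC A (B *m A)) (mxtrace_mulC B (A *m B)).
rewrite -!mulmxA AB.
by rewrite subrKA subrr.
Qed.

(* Here [Q] and [S] are the square roots of [A] and [Q B Q]: with [M := Q D Q],
   the gap is [\tr ((M - S) M^-1 (M - S))]. *)
Lemma fidelity_variational A B D Q S : hpos Q -> hpos S -> hpos B -> hpos D ->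
    Q *m Q = A -> S *m S = Q *m B *m Q ->
  0 <= \tr (A *m D) + \tr (B *m invmx D) - 2 * \tr S ?= iff (D *m A *m D == B).
Proof.
move=> pQ pS pB pD QQ SS.
have hQ := hpos_herm pQ; have uQ := hpos_unit pQ.
have uD := hpos_unit pD.
have hS := hpos_herm pS.
pose M := Q *m D *m Q.
have pM : hpos M by rewrite /M -{1}hQ; apply: hpos_congr.
have uM := hpos_unit pM.
have hM := hpos_herm pM.
have iM : invmx M = invmx Q *m invmx D *m invmx Q.
  have MV : M *m (invmx Q *m invmx D *m invmx Q) = 1%:M.
    by rewrite /M !mulmxA (mulmxK uQ) (mulmxK uD) mulmxV.
  by rewrite -[RHS](mulKmx uM) MV mulmx1.
have := tr_congr_ge0 (M - S) (hpos_inv pM).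
rewrite trmxCD trmxCN hM hS.
have -> : (M - S) *m invmx M *m (M - S) = M - S - S + S *m invmx M *m S.
  rewrite mulmxBl mulmxV // mulmxBr mulmxBl mul1mx (mulmxKV uM).
  by rewrite mulmxBl mul1mx opprB addrA addrAC.
have trM : \tr M = \tr (A *m D) by rewrite /M mxtrace_mulC mulmxA QQ.
have trS : \tr (S *m invmx M *m S) = \tr (B *m invmx D).
  rewrite mxtrace_mulC mulmxA SS iM !mulmxA (mulmxK uQ).
  by rewrite mxtrace_mulC !mulmxA (mulVmx uQ) mul1mx.
(* Cancelling [Q] on both sides, [D A D = B] says that [M] and [S] have the same square; being
   positive definite, they are then equal. *)
have -> : (M - S == 0) = (D *m A *m D == B).
  rewrite subr_eq0; apply/eqP/eqP => [MS|DAD].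
    have : Q *m (D *m A *m D) *m Q = Q *m B *m Q.
      by rewrite -SS -MS /M -QQ !mulmxA.
    move/(congr1 (fun X => invmx Q *m X *m invmx Q)).
    by rewrite !mulmxA !(mulVmx uQ) !mul1mx !(mulmxK uQ).
  by apply: hpos_sqr_inj => //; rewrite SS -DAD /M -QQ !mulmxA.
rewrite -trM -trS !mxtraceD !raddfN /=.
suff -> : \tr M - \tr S - \tr S + \tr (S *m invmx M *m S) =
  \tr M + \tr (S *m invmx M *m S) - 2 * \tr S by [].
by ring.
Qed.

Lemma unitarymxVK U : U \is unitarymx -> U^t* *m U = 1%:M.
Proof. by move=> /unitarymxP/mulmx1C. Qed.

Definition conj_diag U (d : 'rV[C]_m) := U^t* *m diag_mx d *m U.

Lemma conj_diagM U (d e : 'rV[C]_m) : U \is unitarymx ->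
  conj_diag U d *m conj_diag U e = conj_diag U (\row_k (d 0 k * e 0 k)).
Proof.
rewrite /conj_diag => /unitarymxP UU.
rewrite !mulmxA -[_ *m U *m U^t*]mulmxA UU mulmx1.
by rewrite -[_ *m diag_mx d *m _]mulmxA mulmx_diag.
Qed.

Lemma hpos_conj_diag U (d : 'rV[C]_m) : U \is unitarymx ->
  (forall k, 0 < d 0 k) -> hpos (conj_diag U d).
Proof.
by move=> /unitarymx_unit uU d0; apply: hpos_congr => //; apply: hpos_diag.
Qed.

(** With [U] the spectral basis, the eigenvalues are the diagonal entries of [U A U^t*], which is
    positive definite by congruence. *)
Lemma hpos_spectral A : hpos A ->
  A = conj_diag (spectralmx A) (spectral_diag A) /\
  forall k, 0 < spectral_diag A 0 k.
Proof.
rewrite /conj_diag => pA; have uU := spectral_unitarymx A.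
have /hermP/hermitian_normalmx/orthomx_spectralP AE := hpos_herm pA.
rewrite (invmx_unitary uU) in AE; split=> // k.
have uUt : (spectralmx A)^t* \in unitmx by rewrite unitarymx_unit ?trmxC_unitary.
have := hpos_entry_gt0 k (hpos_congr pA uUt).
rewrite trmxCK {2}AE !mulmxA (unitarymxP uU) mul1mx -mulmxA (unitarymxP uU).
by rewrite mulmx1 mxE eqxx.
Qed.

End HermitianPositive.

(** * Certificates of minimality for the Wasserstein mean *)

Section MeanCharacterization.
Set Implicit Arguments.
Unset Strict Implicit.
Context {R : realType} {m : nat}.
Local Notation C := R[i].
Implicit Types A B D X Y : 'M[C]_m.

Lemma ReD (x y : C) : complex.Re (x + y) = complex.Re x + complex.Re y.
Proof. by case: x y => [a b] [c d]. Qed.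

Lemma Re_sum (I : Type) (r : seq I) (P : pred I) (F : I -> C) :
  complex.Re (\sum_(i <- r | P i) F i) = \sum_(i <- r | P i) complex.Re (F i).
Proof. exact: (big_morph _ ReD). Qed.

Lemma funcalcmxE (f : R -> R) A : funcalcmx f A = conj_diag (spectralmx A)
  (map_mx (fun z => (f (complex.Re z))%:C) (spectral_diag A)).
Proof. by rewrite /funcalcmx (invmx_unitary (spectral_unitarymx A)). Qed.

(** The same real eigenvalues [d] serve every [f], so roots, powers and logarithms of [A] are
    compared in one eigenbasis. *)
Lemma posdef_spectral A : posdefmx A -> exists d : 'I_m -> R,
  [/\ forall k, 0 < d k,
      A = conj_diag (spectralmx A) (\row_k (d k)%:C) &
      forall f : R -> R,
        funcalcmx f A = conj_diag (spectralmx A) (\row_k (f (d k))%:C)].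
Proof.
move=> pA; have [AE d0] := hpos_spectral pA.
exists (fun k => complex.Re (spectral_diag A 0 k)).
have dE k : (complex.Re (spectral_diag A 0 k))%:C = spectral_diag A 0 k.
  exact/RRe_real/gtr0_real/d0.
split=> [k||f].
- by have := d0 k; rewrite -dE ltcR.
- by rewrite [LHS]AE; congr conj_diag; apply/rowP => k; rewrite mxE dE.
- by rewrite funcalcmxE; congr conj_diag; apply/rowP => k; rewrite !mxE.
Qed.

Lemma sqrtmx_posdef A : posdefmx A ->
  posdefmx (powmx A 2^-1) /\ powmx A 2^-1 *m powmx A 2^-1 = A.
Proof.
move=> pA; have [d [d0 AE fE]] := posdef_spectral pA.
rewrite /powmx fE; split.
  apply: (hpos_conj_diag (spectral_unitarymx A)) => k.
  by rewrite mxE ltcR powR_gt0.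
rewrite [RHS]AE (conj_diagM _ _ (spectral_unitarymx A)).
congr conj_diag; apply/rowP => k; rewrite !mxE -rmorphM /=.
by rewrite powR12_sqrt ?ltW // -expr2 sqr_sqrtr ?ltW.
Qed.

Lemma fidelity_le A B D : posdefmx A -> posdefmx B -> posdefmx D ->
  0 <= \tr (A *m D) + \tr (B *m invmx D)
       - 2 * \tr (powmx (powmx A 2^-1 *m B *m powmx A 2^-1) 2^-1)
    ?= iff (D *m A *m D == B).
Proof.
move=> pA pB pD; have [pQ QQ] := sqrtmx_posdef pA.
have pQBQ : posdefmx (powmx A 2^-1 *m B *m powmx A 2^-1).
  rewrite -{1}(hpos_herm pQ); apply: (hpos_congr pB); exact: hpos_unit pQ.
have [pS SS] := sqrtmx_posdef pQBQ.
exact: fidelity_variational pQ pS pB pD QQ SS.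
Qed.

(** The lower bound on the squared distance given by the test matrix [D]. It is affine in [A], so a
    weighted sum of such bounds can be constant. *)
Definition dual_bound A B D : R :=
  complex.Re (2^-1 * (\tr A + \tr B - (\tr (A *m D) + \tr (B *m invmx D)))).

Lemma wasserstein_dist_sqr A B : posdefmx A -> posdefmx B ->
  wasserstein_dist A B ^+ 2 = complex.Re (2^-1 * (\tr A + \tr B) -
    \tr (powmx (powmx A 2^-1 *m B *m powmx A 2^-1) 2^-1)).
Proof.
move=> pA pB; rewrite /wasserstein_dist mxtraceZ mxtraceD sqr_sqrtr //.
(* The test matrix 1 shows that the radicand is nonnegative, so squaring undoes [Num.sqrt]. *)
have [+ _] := fidelity_le pA pB hpos1.
rewrite invmx1 !mulmx1; set F := \tr (powmx _ _) => h.
have : 0 <= 2^-1 * (\tr A + \tr B - 2 * F) by rewrite mulr_ge0 ?invr_ge0.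
by rewrite mulrBr mulKf ?pnatr_eq0 // lecE => /andP[].
Qed.

Lemma dual_bound_le A B D : posdefmx A -> posdefmx B -> posdefmx D ->
  dual_bound A B D <= wasserstein_dist A B ^+ 2 ?= iff (D *m A *m D == B).
Proof.
move=> pA pB pD; rewrite wasserstein_dist_sqr // /dual_bound.
have [+ E] := fidelity_le pA pB pD.
set F := \tr (powmx _ _) in E *; set t := \tr (A *m D) + _ in E *.
move=> h; rewrite -E.
have -> : 2^-1 * (\tr A + \tr B) - F =
    2^-1 * (\tr A + \tr B - t) + 2^-1 * (t - 2 * F).
  by field.
have h2 : 0 <= 2^-1 * (t - 2 * F) by rewrite mulr_ge0 ?invr_ge0.
have /complex_realP[r rE] := ger0_real h2.
rewrite rE ReD /=.
rewrite rE in h2.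
split; first by rewrite lerDl -ler0c.
rewrite -[X in X == _]addr0 (inj_eq (addrI _)).
have <- : (0%:C == r%:C :> C) = (0 == r) by rewrite (inj_eq (@complexI R)).
by rewrite -rE eq_sym mulf_eq0 invr_eq0 pnatr_eq0 /= eq_sym.
Qed.

(* By duality every [Y] satisfies [cost Y >= K + \sum_j w_j gap_j(Y)] where the
   gaps vanish simultaneously only at [X]. *)
Lemma wasserstein_meanE {n} (w : 'I_n -> R) (A D : 'I_n -> 'M[C]_m) X :
  pos_prob_vectors w -> posdefmx X -> (forall j, posdefmx (D j)) ->
  (forall j, posdefmx (A j)) ->
  (forall j, D j *m X *m D j = A j) -> \sum_j (w j)%:C *: D j = 1%:M ->
  wasserstein_mean w A = X.
Proof.
move=> [w0 w1] pX pD pA DXD wD.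
pose g Y := \sum_j w j * dual_bound Y (A j) (D j).
(* The linear part of [g] pairs [Y] with [\sum_j w_j (1 - D_j)], which vanishes by [w1] and [wD]. *)
have gX Y : g Y = g X.
  apply/eqP; rewrite -subr_eq0 /g -sumrB.
  have E j : w j * dual_bound Y (A j) (D j) - w j * dual_bound X (A j) (D j) =
     complex.Re (2^-1 * \tr ((Y - X) *m ((w j)%:C *: (1%:M - D j)))).
    rewrite -mulrBr /dual_bound -raddfB /=.
    have ReM (r : R) (z : C) : r * complex.Re z = complex.Re (r%:C * z).
      by case: z => a b /=; rewrite mul0r subr0.
    rewrite ReM; congr complex.Re.
    rewrite -scalemxAr mxtraceZ mulmxBr mulmx1 mulmxBl !raddfB /=.
    by ring.
  rewrite (eq_bigr _ (fun j _ => E j)) -Re_sum -mulr_sumr -mxtrace_sum.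
  rewrite -mulmx_sumr.
  have -> : \sum_j (w j)%:C *: (1%:M - D j) = 0.
    under eq_bigr do rewrite scalerBr.
    by rewrite sumrB wD -scaler_suml -rmorph_sum /= w1 scale1r subrr.
  by rewrite mulmx0 mxtrace0 mulr0.
have le_cost Y : posdefmx Y -> g Y <= wasserstein_cost w A Y
    ?= iff [forall j, D j *m Y *m D j == A j].
  move=> pY.
  have := @leif_sum R _ xpredT (fun j => D j *m Y *m D j == A j)
    (fun j => w j * dual_bound Y (A j) (D j))
    (fun j => w j * wasserstein_dist Y (A j) ^+ 2).
  rewrite -(eq_forallb (fun j => erefl)); apply => j _.
  have [h1 h2] := dual_bound_le pY (pA j) (pD j).
  split; first by rewrite ler_pM2l.
  by rewrite -h2 (inj_eq (mulfI _)) // gt_eqF.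
have costX : wasserstein_cost w A X = g X.
  apply/esym/eqP; rewrite (le_cost X pX).2.
  by apply/forallP => j; rewrite DXD.
have minX : posdefmx X /\ forall Y, posdefmx Y ->
    wasserstein_cost w A X <= wasserstein_cost w A Y.
  split=> [|Y pY]; first exact: pX.
  by rewrite costX; apply: le_trans (le_cost Y pY).1; rewrite (gX Y).
apply: get_subset1; first exact: minX.
suff uX Y : posdefmx Y /\ (forall Z, posdefmx Z ->
    wasserstein_cost w A Y <= wasserstein_cost w A Z) -> Y = X.
  by move=> Y Z /uX -> /uX ->.
move=> [pY mY].
have /forallP DYD : [forall j, D j *m Y *m D j == A j].
  rewrite -(le_cost Y pY).2 eq_le (le_cost Y pY).1 /= (gX Y) -costX.
  exact: mY.
(* One index [j] is enough to cancel [D_j] in [D_j Y D_j = D_j X D_j]; it exists because an empty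
   family of weights does not sum to 1. *)
case: n w A D w0 w1 pD pA DXD wD {g gX le_cost costX minX mY} DYD => [|n] w A D.
  by move=> _ /esym/eqP; rewrite big_ord0 oner_eq0.
move=> _ _ pD _ DXD _ DYD; have uD := hpos_unit (pD ord0).
have := eqP (DYD ord0); rewrite -DXD.
move/(congr1 (fun Z => invmx (D ord0) *m Z *m invmx (D ord0))).
rewrite !mulmxA !(mulVmx uD) !mul1mx.
by rewrite -!mulmxA !(mulmxV uD) !mulmx1.
Qed.

End MeanCharacterization.

(** * The nonlinear part of the certificate system *)

Section Quadratic.
Set Implicit Arguments.
Unset Strict Implicit.
Context {C : numClosedFieldType} {m : nat}.
Implicit Types x c : 'M[C]_m.

(* The part of [(1 + c) (1 + x) (1 + c)] of degree at least two. *)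
Definition quad x c := c *m c + c *m x + x *m c + c *m x *m c.

Lemma congr_quadE x c :
  (1%:M + c) *m (1%:M + x) *m (1%:M + c) = 1%:M + (x + c + c + quad x c).
Proof.
rewrite /quad mulmxDl mul1mx mulmxDr mulmx1 mulmxDr mulmx1 !mulmxDl mul1mx.
by rewrite !addrA [LHS](ACl (1*2*3*5*7*4*6*8)).
Qed.

(** Telescoping leaves exactly one difference in each product; the nine resulting terms give the
    constant of [quad_lip]. *)
Lemma quadB x c x' c' : quad x c - quad x' c' =
  (c - c') *m c + c' *m (c - c') + (c - c') *m x + c' *m (x - x')
  + (x - x') *m c + x' *m (c - c')
  + (c - c') *m x *m c + c' *m (x - x') *m c + c' *m x' *m (c - c').
Proof.
have tele A B A' B' : A *m B - A' *m B' = (A - A') *m B + A' *m (B - B') :> 'M[C]_m.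
  by rewrite mulmxBl mulmxBr subrKA.
have dist4 (a b d e a' b' d' e' : 'M[C]_m) : a + b + d + e - (a' + b' + d' + e') =
    (a - a') + (b - b') + (d - d') + (e - e').
  by rewrite !opprD !addrA [LHS](ACl (1*5*2*6*3*7*4*8)).
by rewrite /quad dist4 !tele [((c - c') *m x + _) *m c]mulmxDl !addrA.
Qed.

Lemma quad_herm x c : x^t* = x -> c^t* = c -> (quad x c)^t* = quad x c.
Proof.
move=> hx hc; rewrite /quad !trmxCD !trmxCM hx hc mulmxA.
by rewrite [LHS](ACl (1*3*2*4)).
Qed.

End Quadratic.

(** * Picard iteration for the certificate system *)

Section LocalSolution.
Set Implicit Arguments.
Unset Strict Implicit.
Context {R : realType} {m n : nat}.
Local Notation C := R[i].
Local Notation M := 'M[C]_m.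
Context (w : 'I_n -> R).
Hypothesis hw : pos_prob_vectors w.

Definition avg (f : 'I_n -> M) : M := \sum_j (w j)%:C *: f j.

Lemma nrm_avg f e : (forall j, nrm (f j) <= e) -> nrm (avg f) <= e.
Proof.
have [w0 w1] := hw => fe; rewrite /avg.
apply: le_trans (nrm_sum _ _ _) _.
rewrite -[leRHS]mul1r -w1 mulr_suml; apply: ler_sum => j _.
by rewrite nrmZr gtr0_norm ?ler_wpM2l // ltW.
Qed.

Lemma avgB f g : avg (fun j => f j - g j) = avg f - avg g.
Proof. by rewrite /avg -sumrB; apply: eq_bigr => j _; rewrite scalerBr. Qed.

Lemma avg_cst A : avg (fun=> A) = A.
Proof.
have [_ w1] := hw.
by rewrite /avg -scaler_suml -rmorph_sum /= w1 scale1r.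
Qed.

Lemma avg_herm f : (forall j, (f j)^t* = f j) -> (avg f)^t* = avg f.
Proof.
move=> hf; rewrite /avg trmxC_sum; apply: eq_bigr => j _.
rewrite trmxCZ hf; congr (_ *: _); exact: conjc_real.
Qed.

Lemma quad_le (x c : M) r : nrm x <= r -> nrm c <= r -> r <= 1 ->
  nrm (quad x c) <= 4 * r ^+ 2.
Proof.
move=> hx hc r1; have r0 : 0 <= r := le_trans (nrm_ge0 x) hx.
have h : nrm (quad x c) <= r * r + r * r + r * r + r * r * r.
  by do ![apply: nrmD_le || apply: nrm_mul_le].
by apply: le_trans h _; nra.
Qed.

Lemma quad_lip (x c x' c' : M) r d : r <= 1 ->
  nrm x <= r -> nrm c <= r -> nrm x' <= r -> nrm c' <= r ->
  nrm (x - x') <= d -> nrm (c - c') <= d ->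
  nrm (quad x c - quad x' c') <= 9 * r * d.
Proof.
move=> r1 hx hc hx' hc' dx dc.
have r0 : 0 <= r := le_trans (nrm_ge0 x) hx.
have d0 : 0 <= d := le_trans (nrm_ge0 _) dx.
have h : nrm (quad x c - quad x' c') <= d * r + r * d + d * r + r * d
    + d * r + r * d + d * r * r + r * d * r + r * r * d.
  by rewrite quadB; do ![apply: nrmD_le || apply: nrm_mul_le].
have rr : r * r <= r by nra.
have rrd : r * r * d <= r * d by rewrite ler_wpM2r.
by apply: le_trans h _; lra.
Qed.

Context (a : 'I_n -> M).
Definition state := (M * ('I_n -> M))%type.
Implicit Types z : state.

(** The equations read [2 c_j = a_j - quad x c_j - x]. Averaging them under the constraint
    [avg c = 0] determines [x], and conversely this choice of [x] makes the new [c_j] average to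
    zero. *)
Definition step z : state :=
  let x := avg (fun j => a j - quad z.1 (z.2 j)) in
  (x, fun j => 2^-1%:C *: (a j - quad z.1 (z.2 j) - x)).

Definition zclose e z z' :=
  nrm (z.1 - z'.1) <= e /\ forall j, nrm (z.2 j - z'.2 j) <= e.
Definition zbound e z := nrm z.1 <= e /\ forall j, nrm (z.2 j) <= e.
Definition zherm z := z.1^t* = z.1 /\ forall j, (z.2 j)^t* = z.2 j.

Lemma nrm_half (A B : M) e : nrm A <= e -> nrm B <= e ->
  nrm (2^-1%:C *: (A - B)) <= e.
Proof.
move=> hA hB; rewrite nrmZr ger0_norm ?invr_ge0 //.
have h : nrm (A - B) <= e + e by apply: le_trans (nrmB _ _) (lerD _ _).
by lra.
Qed.

Variable al : R.
Hypothesis al_le : 36 * al <= 1.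
Hypothesis a_le : forall j, nrm (a j) <= al.

Lemma step_bound z : zbound (2 * al) z -> zbound (2 * al) (step z).
Proof.
move=> [hx hc].
have hq j : nrm (a j - quad z.1 (z.2 j)) <= 2 * al.
  have al0 : 0 <= al := le_trans (nrm_ge0 _) (a_le j).
  have h36 := al_le; have al1 : 2 * al <= 1 by lra.
  apply: le_trans (nrmB _ _) _.
  have al2 : al * (36 * al) <= al * 1 by rewrite ler_wpM2l.
  have hQ := quad_le hx (hc j) al1; have hA := a_le j; lra.
by split=> [|j] /=; [apply: nrm_avg | apply: nrm_half => //; apply: nrm_avg].
Qed.

(** At radius [2 * al] the Lipschitz constant of [quad] is [18 * al]; contraction by one half is
    what fixes the 36 in [al_le]. *)
Lemma step_close z z' e : zbound (2 * al) z -> zbound (2 * al) z' ->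
  zclose e z z' -> zclose (e / 2) (step z) (step z').
Proof.
move=> [hx hc] [hx' hc'] [dx dc].
have e0 : 0 <= e := le_trans (nrm_ge0 _) dx.
have hq j : nrm ((a j - quad z.1 (z.2 j)) - (a j - quad z'.1 (z'.2 j))) <= e / 2.
  have -> (A B D : M) : (A - B) - (A - D) = - (B - D).
    by rewrite opprB addrC addrA subrK opprB.
  rewrite nrmN.
  have al0 : 0 <= al := le_trans (nrm_ge0 _) (a_le j).
  have h36 := al_le; have al1 : 2 * al <= 1 by lra.
  have ale : 36 * al * e <= 1 * e by rewrite ler_wpM2r.
  by apply: le_trans (quad_lip al1 hx (hc j) hx' (hc' j) dx (dc j)) _; lra.
have hX : nrm ((step z).1 - (step z').1) <= e / 2.
  by rewrite /= -avgB; apply: nrm_avg.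
split=> // j.
have dist2 (A X A' X' : M) : A - X - (A' - X') = (A - A') - (X - X').
  by rewrite !opprD addrACA.
have -> : (step z).2 j - (step z').2 j = 2^-1%:C *:
   (((a j - quad z.1 (z.2 j)) - (a j - quad z'.1 (z'.2 j)))
     - ((step z).1 - (step z').1)).
  by rewrite -scalerBr dist2.
exact: nrm_half.
Qed.

Lemma step_herm z : (forall j, (a j)^t* = a j) -> zherm z -> zherm (step z).
Proof.
move=> ha [hx hc].
have hq j : (a j - quad z.1 (z.2 j))^t* = a j - quad z.1 (z.2 j).
  by rewrite trmxCD trmxCN ha quad_herm.
split=> [|j] /=; first exact: avg_herm.
by rewrite trmxCZ trmxCD trmxCN hq avg_herm //; congr (_ *: _); exact: conjc_real.
Qed.

Definition picard k : state := iter k step (0, fun=> 0).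

Lemma picard_bound k : 0 <= al -> zbound (2 * al) (picard k).
Proof.
move=> al0; elim: k => [|k IH]; last exact: step_bound.
by split=> [|j] /=; rewrite nrm0 mulr_ge0.
Qed.

Lemma picard_close k : 0 <= al ->
  zclose (2 * al * (2^-1) ^+ k) (picard k.+1) (picard k).
Proof.
move=> al0; elim: k => [|k IH].
  rewrite expr0 mulr1.
  by have [h1 h2] := picard_bound 1 al0; split=> [|j]; rewrite [X in _ - X]/= subr0.
rewrite exprSr mulrA.
exact: step_close (picard_bound k.+1 al0) (picard_bound k al0) IH.
Qed.

(** Since [u] starts at 0, it is the sequence of partial sums of its increments, dominated by a
    geometric series. *)
Lemma cvg_geometric_dist (u : nat -> M) (b : R) : u 0%N = 0 ->
  (forall k, nrm (u k.+1 - u k) <= b * (2^-1) ^+ k) ->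
  exists L : M, u @ \oo --> L.
Proof.
move=> u0 hu; have cb : cvgn (series (geometric b (2^-1 : R))).
  by apply: is_cvg_geometric_series; rewrite ger0_norm ?invr_ge0 // invf_lt1 // ltr1n.
have [L uL] := cvg_mx_series hu cb.
exists L; suff -> : u = (series (fun k => u k.+1 - u k) : nat -> M) by [].
apply/funext => k; rewrite seriesEnat /= telescope_sumr // u0 subr0 //.
Qed.

Lemma picard_cvg : 0 <= al -> exists z : state,
  forall e : R, 0 < e -> \forall k \near \oo, zclose e (picard k) z.
Proof.
move=> al0; have hx k := (picard_close k al0).1.
have hc j k := (picard_close k al0).2 j.
have [x hX] := cvg_geometric_dist (u := fun k => (picard k).1) erefl hx.
have hC j := cvg_geometric_dist (u := fun k => (picard k).2 j) erefl (hc j).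
exists (x, fun j => projT1 (cid (hC j))) => e e0.
have hC' : \forall k \near \oo, forall j,
    nrm ((picard k).2 j - projT1 (cid (hC j))) < e.
  by apply: filter_forall => j; case: cid => /= c /cvg_nrmP; apply.
move/cvg_nrmP: hX => /(_ _ e0) hX.
by apply: filterS2 hX hC' => k h1 h2; split=> [|j]; apply/ltW => //; apply: h2.
Qed.

(** The bound, the equation and Hermitian symmetry are closed conditions: each passes to the limit
    of the iterates up to an arbitrary [e]. *)
Lemma fixed_point : 0 <= al -> exists z : state,
  [/\ zbound (2 * al) z, step z = z &
     (forall j, (a j)^t* = a j) -> zherm z].
Proof.
move=> al0; have [z zP] := picard_cvg al0; exists z.
have zb : zbound (2 * al) z.
  split=> [|j]; apply/ler_addgt0Pr => e e0;
    have [k [h1 h2]] := filter_ex (zP e e0);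
    have [b1 b2] := picard_bound k al0.
    rewrite -[z.1](subKr (picard k).1) addrC.
    apply: le_trans (nrmD _ _) _; rewrite nrmN addrC lerD //.
  rewrite -[z.2 j](subKr ((picard k).2 j)) addrC.
  by apply: le_trans (nrmD _ _) _; rewrite nrmN addrC lerD.
have small (A B : M) : (forall e : R, 0 < e -> nrm (A - B) <= 2 * e) -> A = B.
  move=> h; apply/subr0_eq/nrm_eq0/eqP; rewrite eq_le nrm_ge0 andbT.
  apply/ler_addgt0Pr => e e0; rewrite add0r.
  have e20 : 0 < e / 2 by rewrite divr_gt0.
  by have := h _ e20; rewrite mulrC divfK.
have zs e : 0 < e -> zclose (2 * e) (step z) z.
  move=> e0.
  have [k _ zk] := zP e e0.
  have [s1 s2] := step_close (picard_bound k al0) zb (zk k (leqnn k)).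
  have [t1 t2] := zk k.+1 (leqnSn k).
  split=> [|j].
    apply: le_trans (nrm_dist_tri (picard k.+1).1 _ _) _.
    rewrite nrm_distC; apply: le_trans (lerD s1 t1) _; lra.
  apply: le_trans (nrm_dist_tri ((picard k.+1).2 j) _ _) _.
  rewrite nrm_distC; apply: le_trans (lerD (s2 j) (t2 j)) _; lra.
split=> // [|ha].
  rewrite [z in RHS]surjective_pairing [LHS]surjective_pairing; congr pair.
    by apply: small => e /zs [].
  by apply/funext => j; apply: small => e /zs [].
have hp k : zherm (picard k).
  by elim: k => [|k IH]; [split=> [|j] /=; rewrite trmx0 map_mx0 | apply: step_herm].
have hsmall (A B : M) e : B^t* = B -> nrm (B - A) <= e -> nrm (A^t* - A) <= 2 * e.
  move=> hB hAB; apply: le_trans (nrm_dist_tri B _ _) _.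
  rewrite mulr2n mulrDl mul1r lerD // -{1}hB -trmxCN -trmxCD nrm_trmxC.
  by rewrite nrm_distC.
split=> [|j]; apply: small => e e0; have [k [h1 h2]] := filter_ex (zP e e0);
  have [p1 p2] := hp k; [exact: hsmall h1 | exact: hsmall (h2 j)].
Qed.

End LocalSolution.

(** * First-order expansion of the mean at the identity *)

Section MeanNearIdentity.
Set Implicit Arguments.
Unset Strict Implicit.
Context {R : realType} {m n : nat}.
Local Notation C := R[i].
Local Notation M := 'M[C]_m.

Lemma normc_sqr (z : C) : (Normc.normc z ^+ 2)%:C = z^*%R * z.
Proof. by rewrite rmorphXn /= mulrC -normCK. Qed.

Lemma normc_sum (I : Type) (r : seq I) (P : pred I) (F : I -> C) :
  Normc.normc (\sum_(i <- r | P i) F i) <= \sum_(i <- r | P i) Normc.normc (F i).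
Proof.
elim/big_rec2: _ => [|i x A _ h]; first by rewrite Normc.normc0.
by apply: le_trans (le_normcD _ _) _; rewrite lerD2l.
Qed.

Lemma normc_quadratic_le (x : M) (v : 'cV[C]_m) :
  Normc.normc ((v^t* *m x *m v) 0 0) <=
  nrm x * \sum_i Normc.normc (v i 0) ^+ 2.
Proof.
set s := \sum_i _.
have vs i : Normc.normc (v i 0) ^+ 2 <= s.
  by rewrite /s (bigD1 i) //= lerDl sumr_ge0 // => k _; apply: sqr_ge0.
rewrite mxE; apply: le_trans (normc_sum _ _ _) _.
rewrite /nrm exchange_big /= mulr_suml; apply: ler_sum => j _.
rewrite mxE mulr_suml; apply: le_trans (normc_sum _ _ _) _.
rewrite mulr_suml; apply: ler_sum => i _.
rewrite !Normc.normcM !mxE normc_conj mulrAC mulrC ler_wpM2l ?normc_ge0 //.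
have hi := vs i; have hj := vs j.
(* Arithmetic-geometric inequality: the product of two coordinate moduli is at most half the sum of
   their squares, hence at most [s]. *)
have sq := sqr_ge0 (Normc.normc (v i 0) - Normc.normc (v j 0)).
by nra.
Qed.

(** The form of [x] at [v] is real and at most [nrm x * s < s] in modulus, where [s] is the squared
    length of [v]. *)
Lemma posdef_near1 (x : M) : x^t* = x -> nrm x < 1 -> posdefmx (1%:M + x).
Proof.
move=> hx x1; split; first by apply/hermP; rewrite trmxCD trmxC1 hx.
move=> v v0; rewrite mulmxDr mulmxDl mulmx1 mxE.
pose s : R := \sum_i Normc.normc (v i 0) ^+ 2.
have sE : (v^t* *m v) 0 0 = s%:C.
  rewrite mxE rmorph_sum; apply: eq_bigr => i _.
  by rewrite !mxE; apply/esym/normc_sqr.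
have s0 : 0 < s.
  have [i vi0] : exists i, v i 0 != 0.
    apply/existsP; apply: contraNT v0; rewrite negb_exists => /forallP h.
    by apply/eqP/matrixP => i j; rewrite ord1 mxE; apply/eqP/negPn/h.
  rewrite /s (bigD1 i) //= ltr_wpDr ?sumr_ge0 // => [k _|]; first exact: sqr_ge0.
  rewrite exprn_gt0 // lt_def normc_ge0 andbT.
  by apply: contraNneq vi0 => /Normc.eq0_normc ->.
have hz : ((v^t* *m x *m v) 0 0)^*%R = (v^t* *m x *m v) 0 0.
  have : (v^t* *m x *m v)^t* = v^t* *m x *m v by rewrite !trmxCM trmxCK hx mulmxA.
  by move/matrixP/(_ 0 0); rewrite !mxE.
have /complex_realP[r rE] : (v^t* *m x *m v) 0 0 \is Num.real by apply/CrealP.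
have := normc_quadratic_le x v; rewrite sE rE normc_real -/s -rmorphD ltcR => h.
have : nrm x * s < s by rewrite gtr_pMl.
move: h; rewrite ler_norml => /andP[h _] h'; lra.
Qed.

Lemma wasserstein_mean_near1 (w : 'I_n -> R) (A : 'I_n -> M) al :
  pos_prob_vectors w -> 0 <= al -> 36 * al <= 1 ->
  (forall j, posdefmx (A j)) -> (forall j, nrm (A j - 1%:M) <= al) ->
  [/\ posdefmx (wasserstein_mean w A),
      nrm (wasserstein_mean w A - 1%:M) <= 2 * al &
      nrm (wasserstein_mean w A - 1%:M - avg w (fun j => A j - 1%:M))
        <= 16 * al ^+ 2].
Proof.
move=> hw al0 al36 pA hA.
have [[x c] [[/= bx bc] st hz]] := fixed_point hw al36 hA al0.
have hE j : (A j - 1%:M)^t* = A j - 1%:M.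
  by rewrite trmxCD trmxCN trmxC1 (hpos_herm (pA j)).
have [/= hx hc] := hz hE.
have al1 : 2 * al < 1 by lra.
have pX : posdefmx (1%:M + x) by apply: posdef_near1 => //; apply: le_lt_trans al1.
have pD j : posdefmx (1%:M + c j).
  by apply: posdef_near1 => //; apply: le_lt_trans al1.
case: st => xE cE.
have cjE j : c j + c j = A j - 1%:M - quad x (c j) - x.
  rewrite -{1 2}cE xE -mulr2n -scaler_nat scalerA.
  have -> : 2%:R * (2^-1)%:C = 1 :> C.
    by rewrite -(rmorph_nat (real_complex R)) -rmorphM divff // pnatr_eq0.
  by rewrite scale1r.
have -> : wasserstein_mean w A = 1%:M + x.
  apply: (wasserstein_meanE hw pX pD pA) => [j|].
    rewrite congr_quadE -[x + c j + c j]addrA cjE [x + _]addrC subrK subrK.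
    by rewrite addrC subrK.
  have -> : \sum_j (w j)%:C *: (1%:M + c j) = 1%:M + avg w c.
    rewrite /avg -{2}(avg_cst hw 1%:M) /avg -big_split /=.
    by apply: eq_bigr => j _; rewrite scalerDr.
  suff -> : avg w c = 0 by rewrite addr0.
  (* Averaging [cjE] gives [2 avg c = x - x], by the equation for [x]. *)
  apply/(@scalerI _ _ (2%:R : C)); first by rewrite pnatr_eq0.
  rewrite scaler0 scaler_nat mulr2n /avg -big_split /=.
  under eq_bigr => j _ do rewrite -scalerDr cjE.
  by rewrite -/(avg w (fun j => A j - 1%:M - quad x (c j) - x)) avgB xE avg_cst // subrr.
have -> : 1%:M + x - 1%:M = x by rewrite addrC addKr.
split; [exact: pX | exact: bx |].
rewrite -{1}xE avgB addrAC subrr sub0r nrmN.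
have al1' := ltW al1.
have -> : 16 * al ^+ 2 = 4 * (2 * al) ^+ 2 by ring.
by apply: (nrm_avg hw) => j; apply: quad_le.
Qed.

End MeanNearIdentity.

(** * Powers and diagonalized matrices *)

Section GenericPowers.
Set Implicit Arguments.
Unset Strict Implicit.
Context {C : numClosedFieldType} {m : nat}.
Implicit Types A B U : 'M[C]_m.

Lemma mxexpS A k : A ^+ k.+1 = A *m A ^+ k. Proof. exact: exprS. Qed.

Lemma mxexpSr A k : A ^+ k.+1 = A ^+ k *m A. Proof. exact: exprSr. Qed.

Lemma mxexpB A B k :
  A ^+ k.+1 - B ^+ k.+1 = A *m (A ^+ k - B ^+ k) + (A - B) *m B ^+ k.
Proof. by rewrite !mxexpS mulmxBr mulmxBl subrKA. Qed.

Lemma conj_diagD U (d e : 'rV[C]_m) :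
  conj_diag U (d + e) = conj_diag U d + conj_diag U e.
Proof. by rewrite /conj_diag raddfD mulmxDr mulmxDl. Qed.

Lemma conj_diagZ U (z : C) (d : 'rV[C]_m) :
  conj_diag U (z *: d) = z *: conj_diag U d.
Proof. by rewrite /conj_diag linearZ /= -scalemxAr -scalemxAl. Qed.

Lemma conj_diag1 U : U \is unitarymx -> conj_diag U (const_mx 1) = 1%:M.
Proof. by move=> uU; rewrite /conj_diag diag_const_mx mulmx1 unitarymxVK. Qed.

Lemma conj_diagX U (d : 'rV[C]_m) k : U \is unitarymx ->
  conj_diag U d ^+ k = conj_diag U (\row_i (d 0 i ^+ k)).
Proof.
move=> uU; elim: k => [|k IH].
  rewrite expr0 -[LHS](conj_diag1 uU); congr conj_diag.
  by apply/rowP => i; rewrite !mxE expr0.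
rewrite mxexpS IH conj_diagM //; congr conj_diag.
by apply/rowP => i; rewrite !mxE exprS.
Qed.

Lemma conj_diag_sum U (I : Type) (r : seq I) (P : pred I) (F : I -> 'rV[C]_m) :
  conj_diag U (\sum_(i <- r | P i) F i) = \sum_(i <- r | P i) conj_diag U (F i).
Proof.
apply: (big_morph _ (conj_diagD U)).
by rewrite -[0 in LHS](scale0r (0 : 'rV[C]_m)) conj_diagZ scale0r.
Qed.

End GenericPowers.

(** * Matrix exponential and logarithm *)

Section ExpLog.
Set Implicit Arguments.
Unset Strict Implicit.
Context {R : realType} {m : nat}.
Local Notation C := R[i].
Local Notation M := 'M[C]_m.
Implicit Types A B X : M.

Lemma nrmX A r k : nrm A <= r -> nrm (A ^+ k) <= nrm (1%:M : M) * r ^+ k.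
Proof.
move=> hA; elim: k => [|k IH]; first by rewrite !expr0 mulr1.
by rewrite mxexpSr exprSr mulrA; apply: nrm_mul_le.
Qed.

Lemma nrmXB A B r k : nrm A <= r -> nrm B <= r ->
  nrm (A ^+ k.+1 - B ^+ k.+1) <= k.+1%:R * r ^+ k * nrm (A - B).
Proof.
move=> hA hB; have r0 : 0 <= r := le_trans (nrm_ge0 A) hA.
(* Keeping [A - B] as the first factor avoids the constant [nrm 1%:M] that a bound on [B ^+ l] alone
   would cost. *)
have hAB l : nrm ((A - B) *m B ^+ l) <= r ^+ l * nrm (A - B).
  elim: l => [|l IH]; first by rewrite !expr0 mulmx1 mul1r.
  by rewrite mxexpSr mulmxA exprSr mulrAC; apply: nrm_mul_le.
elim: k => [|k IH]; first by rewrite !expr1 expr0 !mul1r.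
rewrite mxexpB -natr1 !mulrDl mul1r; apply: nrmD_le; last exact: hAB.
by rewrite [r ^+ _]exprS mulrCA -mulrA; apply: nrm_mul_le.
Qed.

Definition exp_term A k : M := (k`!%:R)^-1 *: A ^+ k.

Lemma nrm_factV (k : nat) A : nrm ((k`!%:R)^-1 *: A) = (k`!%:R)^-1 * nrm A.
Proof.
rewrite nrmZ; congr (_ * _).
rewrite Normc.normcV -(rmorph_nat (real_complex R)) normc_real ger0_norm //.
Qed.

Lemma cvg_expmx A :
  (series (exp_term A) : nat -> M) @ \oo --> expmx A.
Proof.
have hb k : nrm (exp_term A k) <= (nrm (1%:M : M) *: exp_coeff (nrm A)) k.
  rewrite /exp_term nrm_factV /exp_coeff /= mulrC.
  rewrite [leRHS]mulrA ler_wpM2r ?invr_ge0 //; exact: nrmX.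
have cb : cvgn (series (nrm (1%:M : M) *: exp_coeff (nrm A))).
  by apply: is_cvg_seriesZ; apply: is_cvg_series_exp_coeff.
have [L uL] := cvg_mx_series hb cb.
by rewrite /expmx (_ : lim _ = L) //; exact: cvg_mx_unique uL.
Qed.

Lemma series_exp_coeff_le (r : R) N : 0 <= r -> series (exp_coeff r) N <= expR r.
Proof.
move=> r0; apply: nondecreasing_cvgn_le; last exact: is_cvg_series_exp_coeff.
apply/nondecreasing_seqP => k; rewrite seriesSr lerDl.
by rewrite /exp_coeff /= divr_ge0 ?exprn_ge0.
Qed.

Lemma nrm_seriesB (u v : nat -> M) (b : nat -> R) N :
  (forall k, nrm (u k - v k) <= b k) ->
  nrm (series u N - series v N) <= \sum_(0 <= k < N) b k.
Proof.
move=> h; rewrite /series /= -sumrB; apply: le_trans (nrm_sum _ _ _) _.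
by apply: ler_sum => k _; apply: h.
Qed.

Lemma expmx_lip A B r : nrm A <= r -> nrm B <= r ->
  nrm (expmx A - expmx B) <= expR r * nrm (A - B).
Proof.
have split3 (x y z b e : R) : x <= e / 2 -> y <= b -> z <= e / 2 ->
  x + (y + z) <= b + e by lra.
move=> hA hB; have r0 : 0 <= r := le_trans (nrm_ge0 A) hA.
have partial N : nrm (series (exp_term A) N - series (exp_term B) N)
    <= expR r * nrm (A - B).
  (* The constant terms cancel, and [(l + 1) r^l / (l + 1)! = r^l / l!] turns the bounds back into
     an exponential series. *)
  pose b k := if k is l.+1 then exp_coeff r l * nrm (A - B) else 0.
  apply: (@le_trans _ _ (\sum_(0 <= k < N) b k)).
    apply: nrm_seriesB => -[|k].
      by rewrite /exp_term !expr0 subrr nrm0.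
    rewrite /exp_term -scalerBr nrm_factV.
    apply: (@le_trans _ _ (k.+1`!%:R^-1 * (k.+1%:R * r ^+ k * nrm (A - B)))).
      by rewrite ler_wpM2l ?invr_ge0 // nrmXB.
    rewrite le_eqVlt; apply/orP; left; apply/eqP.
    rewrite /b /exp_coeff /= factS natrM; field.
    by rewrite nat1r !pnatr_eq0 -lt0n fact_gt0.
  case: N => [|N]; first by rewrite big_geq // mulr_ge0 ?nrm_ge0 // expR_ge0.
  rewrite big_nat_recl // add0r -mulr_suml ler_wpM2r ?nrm_ge0 //.
  have := series_exp_coeff_le N r0; by rewrite seriesEnat.
apply/ler_addgt0Pr => e e0.
have e20 : 0 < e / 2 by rewrite divr_gt0.
have /cvg_nrmP/(_ _ e20) hAe := @cvg_expmx A.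
have /cvg_nrmP/(_ _ e20) hBe := @cvg_expmx B.
have [N [h1 h2]] := filter_ex (filterI hAe hBe).
apply: le_trans (nrm_dist_tri (series (exp_term A) N) _ _) _.
rewrite nrm_distC.
apply: le_trans (lerD (ltW h1) (nrm_dist_tri (series (exp_term B) N) _ _)) _.
exact: split3 (lexx _) (partial N) (ltW h2).
Qed.

Lemma nrm_diag (d : 'rV[C]_m) : nrm (diag_mx d) = \sum_k Normc.normc (d 0 k).
Proof.
apply: eq_bigr => i _; rewrite (bigD1 i) //= big1 => [|j /negPf ji].
  by rewrite mxE eqxx mulr1n addr0.
by rewrite mxE eq_sym ji mulr0n Normc.normc0.
Qed.

(** Rows of [U] have length 1, so each entry has modulus at most 1. *)
Lemma nrm_unitary (U : M) : U \is unitarymx -> nrm U <= (m * m)%:R.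
Proof.
move=> /unitarymxP UU; apply: (@le_trans _ _ (\sum_(i < m) \sum_(j < m) (1 : R))).
  apply: ler_sum => i _; apply: ler_sum => j _.
  have h : \sum_k Normc.normc (U i k) ^+ 2 = 1.
    apply: complexI; rewrite rmorph_sum.
    have /matrixP/(_ i i) := UU; rewrite !mxE eqxx => h; apply: etrans h.
    apply: eq_bigr => k _; rewrite !mxE mulrC; exact: normc_sqr.
  have : Normc.normc (U i j) ^+ 2 <= 1.
    by rewrite -h (bigD1 j) //= lerDl sumr_ge0 // => k _; apply: sqr_ge0.
  by rewrite expr_le1 // normc_ge0.
by rewrite !sumr_const !card_ord -mulrnA.
Qed.

Lemma nrm_conj_diag (U : M) (d : 'I_m -> R) : U \is unitarymx ->
  nrm (conj_diag U (\row_k (d k)%:C)) <= (m * m)%:R ^+ 2 * \sum_k `|d k|.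
Proof.
move=> uU.
have h : nrm (conj_diag U (\row_k (d k)%:C)) <=
   (m * m)%:R * (\sum_k `|d k|) * (m * m)%:R.
  apply: nrm_mul_le; last exact: nrm_unitary.
  apply: nrm_mul_le; first by rewrite nrm_trmxC nrm_unitary.
  by rewrite nrm_diag; apply: ler_sum => k _; rewrite mxE normc_real.
by apply: le_trans h _; rewrite mulrAC -expr2.
Qed.

Lemma conj_diag_realB (U : M) (d e : 'I_m -> R) :
  conj_diag U (\row_k (d k)%:C) - conj_diag U (\row_k (e k)%:C) =
  conj_diag U (\row_k (d k - e k)%:C).
Proof.
rewrite -scaleN1r -conj_diagZ -conj_diagD; congr conj_diag.
by apply/rowP => k; rewrite !mxE mulN1r rmorphB.
Qed.

Lemma expmx_conj_diag (U : M) (d : 'I_m -> R) : U \is unitarymx ->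
  expmx (conj_diag U (\row_k (d k)%:C)) = conj_diag U (\row_k (expR (d k))%:C).
Proof.
move=> uU; set A := conj_diag U _; set L := conj_diag U _.
suff AL : (series (exp_term A) : nat -> M) @ \oo --> L.
  by rewrite -(cvg_mx_unique AL); apply/esym/cvg_mx_unique/cvg_expmx.
have sE N : series (exp_term A) N =
    conj_diag U (\row_k (series (exp_coeff (d k)) N)%:C).
  rewrite [LHS]/series /= (eq_bigr (fun i => conj_diag U (\row_k (exp_coeff (d k) i)%:C))).
    rewrite -conj_diag_sum; congr conj_diag; apply/rowP => k.
    rewrite summxE !mxE seriesEnat /= rmorph_sum; apply: eq_bigr => i _.
    by rewrite mxE.
  move=> i _; rewrite /exp_term conj_diagX // -conj_diagZ; congr conj_diag.
  apply/rowP => k; rewrite !mxE /exp_coeff /= rmorphM rmorphXn mulrC.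
  by rewrite fmorphV rmorph_nat.
apply/cvg_nrmP => e e0.
pose K : R := (m * m)%:R ^+ 2.
have K0 : 0 <= K * m%:R by rewrite mulr_ge0 // exprn_ge0.
(* Adding 1 covers [m = 0] and makes the final inequality strict. *)
have K1 : 0 < K * m%:R + 1 by rewrite ltr_wpDl.
have d0 : 0 < e / (K * m%:R + 1) by rewrite divr_gt0.
have near_exp : \forall N \near \oo, forall k : 'I_m,
    `|series (exp_coeff (d k)) N - expR (d k)| < e / (K * m%:R + 1).
  apply: filter_forall => k.
  have /cvgrPdist_lt/(_ _ d0) := @is_cvg_series_exp_coeff R (d k).
  by apply: filterS => N; rewrite distrC.
apply: filterS near_exp => N hN.
rewrite sE conj_diag_realB; apply: le_lt_trans (nrm_conj_diag _ uU) _.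
have hs : \sum_k `|series (exp_coeff (d k)) N - expR (d k)| <=
    m%:R * (e / (K * m%:R + 1)).
  apply: le_trans (ler_sum _ (fun k _ => ltW (hN k))) _.
  by rewrite sumr_const card_ord mulr_natl.
apply: le_lt_trans (ler_wpM2l (exprn_ge0 2 (ler0n _ _)) hs) _.
rewrite -/K [K * (_ * _)]mulrA [_ * (e / _)]mulrCA gtr_pMr // ltr_pdivrMr // mul1r.
by rewrite ltrDl.
Qed.

(** The inequality [ln (1 + x) <= x], used at [d] and at [d^-1], encloses [ln d] between [1 - d^-1]
    and [d - 1]. The gap is [(d - 1)^2 / d], and [d^-1 <= 2]. *)
Lemma ln_sub_le (d : R) : `|d - 1| <= 2^-1 -> `|ln d - (d - 1)| <= 2 * (d - 1) ^+ 2.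
Proof.
move=> hd; have d0 : 2^-1 <= d by move: hd; rewrite ler_norml => /andP[]; lra.
have dp : 0 < d by lra.
have h1 : ln d <= d - 1.
  by have := @le_ln1Dx R (d - 1); rewrite addrCA subrr addr0; apply; lra.
have h2 : - ln d <= d^-1 - 1.
  rewrite -lnV ?posrE //.
  have := @le_ln1Dx R (d^-1 - 1); rewrite addrCA subrr addr0; apply.
  by have := invr_gt0 d; rewrite dp; lra.
have h3 : d - 1 - (1 - d^-1) <= 2 * (d - 1) ^+ 2.
  have -> : d - 1 - (1 - d^-1) = d^-1 * (d - 1) ^+ 2 by field; rewrite gt_eqF.
  by rewrite ler_wpM2r ?sqr_ge0 // -[leRHS]invrK lef_pV2 ?posrE ?invr_gt0.
by rewrite ler_norml; apply/andP; split; lra.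
Qed.

(** With [K = m * m], passing to the eigenbasis bounds each [d_k - 1] by [K^2 b]. The scalar
    estimate squares this, and returning from the eigenbasis costs another [K^2]: hence the sixth
    power. *)
Lemma ln_near1 X b : posdefmx X -> nrm (X - 1%:M) <= b ->
    (m * m)%:R ^+ 2 * b <= 2^-1 ->
  nrm (funcalcmx (@ln R) X - (X - 1%:M)) <= 2 * m%:R * (m * m)%:R ^+ 6 * b ^+ 2.
Proof.
move=> pX hX hb; have [d [d0 XE fE]] := posdef_spectral pX.
have uU := spectral_unitarymx X; set U := spectralmx X in XE fE uU *.
have X1 : X - 1%:M = conj_diag U (\row_k (d k - 1)%:C).
  rewrite -conj_diag_realB -XE; congr (_ - _).
  rewrite -[LHS](conj_diag1 uU); congr conj_diag.
  by apply/rowP => k; rewrite !mxE.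
pose K : R := (m * m)%:R.
have dk k : `|d k - 1| <= K ^+ 2 * b.
  have : nrm (U *m (X - 1%:M) *m U^t*) <= K * b * K.
    apply: nrm_mul_le; last by rewrite nrm_trmxC nrm_unitary.
    by apply: nrm_mul_le => //; apply: nrm_unitary.
  rewrite mulrAC -expr2; apply: le_trans.
  rewrite X1 /conj_diag !mulmxA (unitarymxP uU) mul1mx -mulmxA (unitarymxP uU) mulmx1.
  rewrite -normc_real; apply: le_trans (le_normc_nrm _ k k).
  by rewrite !mxE eqxx mulr1n.
rewrite fE X1 conj_diag_realB; apply: le_trans (nrm_conj_diag _ uU) _.
have hs : \sum_k `|ln (d k) - (d k - 1)| <= \sum_(k < m) 2 * (K ^+ 2 * b) ^+ 2.
  apply: ler_sum => k _; apply: le_trans (ln_sub_le (le_trans (dk k) hb)) _.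
  rewrite ler_pM2l // -real_normK ?num_real // lerXn2r ?nnegrE //.
  exact: le_trans (normr_ge0 _) (dk k).
rewrite sumr_const card_ord -mulr_natl in hs.
apply: le_trans (ler_wpM2l (exprn_ge0 2 (ler0n _ _)) hs) _.
by rewrite le_eqVlt; apply/orP; left; apply/eqP; rewrite /K; ring.
Qed.

(** On positive eigenvalues [powR] is [expR (r * ln d)], for [r] of either sign; this covers
    negative [s] as well. *)
Lemma powmx_expmx X r : posdefmx X ->
  powmx X r = expmx (r%:C *: funcalcmx (@ln R) X).
Proof.
move=> pX; have [d [d0 XE fE]] := posdef_spectral pX.
rewrite /powmx !fE -conj_diagZ.
have -> : r%:C *: (\row_k (ln (d k))%:C) = \row_k (r * ln (d k))%:C :> 'rV[C]_m.
  by apply/rowP => k; rewrite !mxE rmorphM.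
rewrite (expmx_conj_diag _ (spectral_unitarymx X)); congr conj_diag.
by apply/rowP => k; rewrite !mxE /powR gt_eqF.
Qed.

End ExpLog.

(** * The limit along differentiable curves *)

Section LieTrotter.
Set Implicit Arguments.
Unset Strict Implicit.
Context {R : realType} {m n : nat}.
Local Notation C := R[i].
Local Notation M := 'M[C]_m.

(** The 8 comes from [ln_near1] with [b = 2 * al], the 16 from the expansion of the mean itself. *)
Lemma log_mean_estimate (w : 'I_n -> R) (A : 'I_n -> M) al :
  pos_prob_vectors w -> 0 <= al -> 36 * al <= 1 ->
  (m * m)%:R ^+ 2 * (2 * al) <= 2^-1 ->
  (forall j, posdefmx (A j)) -> (forall j, nrm (A j - 1%:M) <= al) ->
  nrm (funcalcmx (@ln R) (wasserstein_mean w A) - avg w (fun j => A j - 1%:M))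
    <= (8 * m%:R * (m * m)%:R ^+ 6 + 16) * al ^+ 2.
Proof.
move=> hw al0 al36 alm pA hA.
have [pX hX hXa] := wasserstein_mean_near1 hw al0 al36 pA hA.
have hL := ln_near1 pX hX alm.
apply: le_trans (nrm_dist_tri _ _ _) (le_trans (lerD hL hXa) _).
by rewrite le_eqVlt; apply/orP; left; apply/eqP; ring.
Qed.

Lemma cvg_expmx_comp {T : Type} (F : set_system T) {FF : Filter F}
    (f : T -> M) (L : M) : f @ F --> L -> (fun x => expmx (f x)) @ F --> expmx L.
Proof.
move=> /cvg_nrmP fL; apply/cvg_nrmP => e e0.
pose r := nrm L + 1.
have d0 : 0 < e / expR r by rewrite divr_gt0 // expR_gt0.
apply: filterS2 (fL 1 ltr01) (fL _ d0) => x h1 h2.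
have hf : nrm (f x) <= r.
  rewrite -[f x](subrK L) addrC; apply: nrmD_le => //; exact: ltW.
have hl : nrm L <= r by rewrite lerDl.
apply: le_lt_trans (expmx_lip hf hl) _.
by rewrite mulrC -ltr_pdivlMr // expR_gt0.
Qed.

Context (w : 'I_n -> R) (hw : pos_prob_vectors w) (eps : R) (heps : 0 < eps).
Context (gamma : 'I_n -> R -> M) (D : 'I_n -> M).
Hypothesis gamma_pos : forall j s, s \in `]- eps, eps[ -> posdefmx (gamma j s).
Hypothesis gamma0 : forall j, gamma j 0 = 1%:M.
Hypothesis gammaD : forall j, curve_quotient (gamma j) 0 @ 0^' --> D j.

(** A common bound for the difference quotients near 0: the added 1 absorbs their distance to the
    derivatives and keeps [B] positive. *)
Let B := \sum_j nrm (D j) + 1.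

Let B_gt0 : 0 < B.
Proof. by rewrite /B ltr_wpDl // sumr_ge0 // => k _; apply: nrm_ge0. Qed.

Lemma curve_quotientE j s : s != 0 ->
  gamma j s - 1%:M = s%:C *: curve_quotient (gamma j) 0 s.
Proof.
move=> s0; rewrite /curve_quotient addr0 gamma0 scalerA -rmorphM divff //.
by rewrite scale1r.
Qed.

Lemma near_curve d : 0 < d -> d <= 1 -> \forall s \near (0 : R)^',
  [/\ s != 0, forall j, posdefmx (gamma j s),
      forall j, nrm (gamma j s - 1%:M) <= `|s| * B &
      forall j, nrm (curve_quotient (gamma j) 0 s - D j) < d].
Proof.
move=> d0 d1.
have nq : \forall s \near (0 : R)^', forall j,
    nrm (curve_quotient (gamma j) 0 s - D j) < d.
  by apply: filter_forall => j; have /cvg_nrmP := @gammaD j; apply.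
near=> s.
have s0 : s != 0 by near: s; apply: nbhs_dnbhs_neq.
have hq : forall j, nrm (curve_quotient (gamma j) 0 s - D j) < d by near: s.
have se : `|s| < eps by near: s; apply: dnbhs0_lt.
split=> // j; first by apply: gamma_pos; rewrite in_itv /= -ltr_norml.
rewrite curve_quotientE // nrmZr ler_wpM2l //.
rewrite -[curve_quotient _ _ _](subrK (D j)) addrC /B.
apply: nrmD_le; last exact: ltW (lt_le_trans (hq j) d1).
by rewrite (bigD1 j) //= lerDl sumr_ge0 // => k _; apply: nrm_ge0.
Unshelve. all: by end_near. Qed.

Lemma near_small (c q : R) : 0 < q -> 0 < c ->
  \forall s \near (0 : R)^', `|s| * q <= c.
Proof.
move=> q0 c0; have cq : 0 < c / q by rewrite divr_gt0.
by apply: filterS (dnbhs0_lt cq) => s /ltW; rewrite ler_pdivlMr.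
Qed.

Lemma near_mean_posdef : \forall s \near (0 : R)^',
  posdefmx (wasserstein_mean w (fun j => gamma j s)).
Proof.
have q0 : 0 < 36 * B by rewrite mulr_gt0.
apply: filterS2 (near_curve ltr01 (lexx 1)) (near_small q0 ltr01) => s.
move=> [_ pA hA _] hs.
have al0 : 0 <= `|s| * B by rewrite mulr_ge0 // ltW.
have al1 : 36 * (`|s| * B) <= 1 by rewrite mulrCA.
by have [] := wasserstein_mean_near1 hw al0 al1 pA hA.
Qed.

Lemma cvg_log_mean :
  (fun s => s^-1%:C *:
     funcalcmx (@ln R) (wasserstein_mean w (fun j => gamma j s))) @ 0^' -->
    avg w D.
Proof.
apply/cvg_nrmP => e e0.
pose K : R := (m * m)%:R.
pose Q : R := 8 * m%:R * K ^+ 6 + 16.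
have Q0 : 0 < Q by rewrite ltr_wpDl // !mulr_ge0 // exprn_ge0.
(* The 1 is required by [near_curve]; [e / 2] is the share of the error left to the difference
   quotients. *)
pose d := Num.min 1 (e / 2).
have d0 : 0 < d by rewrite lt_min ltr01 divr_gt0.
have d1 : d <= 1 by rewrite ge_min lexx.
have d2 : d <= e / 2 by rewrite ge_min lexx orbT.
have q1 : 0 < 36 * B by rewrite mulr_gt0.
have q2 : 0 < (K ^+ 2 + 1) * (2 * B).
  by rewrite !mulr_gt0 // ltr_wpDl // exprn_ge0.
have q3 : 0 < Q * B ^+ 2 by rewrite mulr_gt0 // exprn_gt0.
have e4 : 0 < e / 4 by rewrite divr_gt0.
have half0 : 0 < 2^-1 :> R by rewrite invr_gt0.
near=> s.
have [s0 pA hA hq] : [/\ s != 0, forall j, posdefmx (gamma j s),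
    forall j, nrm (gamma j s - 1%:M) <= `|s| * B &
    forall j, nrm (curve_quotient (gamma j) 0 s - D j) < d].
  by near: s; apply: near_curve.
have s1 : `|s| * (36 * B) <= 1 by near: s; apply: near_small.
have s2 : `|s| * ((K ^+ 2 + 1) * (2 * B)) <= 2^-1 by near: s; apply: near_small.
have s3 : `|s| * (Q * B ^+ 2) <= e / 4 by near: s; apply: near_small.
have as0 : 0 < `|s| by rewrite normr_gt0.
have al0 : 0 <= `|s| * B by rewrite mulr_ge0 // ltW.
have al1 : 36 * (`|s| * B) <= 1 by rewrite mulrCA.
have al2 : K ^+ 2 * (2 * (`|s| * B)) <= 2^-1.
  apply: le_trans s2.
  have -> : K ^+ 2 * (2 * (`|s| * B)) = `|s| * (K ^+ 2 * (2 * B)) by ring.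
  by rewrite ler_pM2l // ler_pM2r ?lerDl // mulr_gt0.
have hH := log_mean_estimate hw al0 al1 al2 pA hA.
set H := funcalcmx _ _ in hH *.
(* The first summand is a quadratic error divided by [s], hence of order [s]; the second is the
   averaged error of the difference quotients. *)
have -> : s^-1%:C *: H - avg w D =
    s^-1%:C *: (H - avg w (fun j => gamma j s - 1%:M)) +
    avg w (fun j => curve_quotient (gamma j) 0 s - D j).
  have -> : avg w (fun j => gamma j s - 1%:M) =
      s%:C *: avg w (fun j => curve_quotient (gamma j) 0 s).
    rewrite /avg scaler_sumr; apply: eq_bigr => j _.
    by rewrite (curve_quotientE _ s0) !scalerA [(w j)%:C * _]mulrC.
  rewrite scalerBr scalerA -rmorphM mulVf // scale1r.
  by rewrite [X in _ = _ + X]avgB subrKA.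
apply: le_lt_trans (nrmD _ _) _; rewrite (splitr e); apply: ltr_leD; last first.
  by apply: (nrm_avg hw) => j; apply: ltW (lt_le_trans (hq j) d2).
rewrite nrmZr normfV mulrC ltr_pdivrMr //.
apply: le_lt_trans hH _; rewrite -/K -/Q.
have -> : Q * (`|s| * B) ^+ 2 = `|s| * (Q * B ^+ 2) * `|s| by ring.
rewrite ltr_pM2r //; apply: le_lt_trans s3 _.
by rewrite ltr_pM2l // ltf_pV2 ?posrE // ltr_nat.
Unshelve. all: by end_near. Qed.

End LieTrotter.

Theorem theorem5p2 (R : realType) (m n : nat) (w : 'I_n -> R)
  (hw : pos_prob_vectors w)
  (eps : R) (heps : 0 < eps)
  (gamma : 'I_n -> R -> 'M[R[i]]_m)
  (gamma_pos : forall j (s : R), s \in `]- eps, eps[ -> posdefmx (gamma j s))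
  (gamma_diff : forall j (s : R), s \in `]- eps, eps[ -> curve_derivable (gamma j) s)
  (gamma0 : forall j, gamma j 0 = 1%:M) :
  powmx (wasserstein_mean w (fun j => gamma j s)) s^-1 @[s --> 0^']
    --> expmx (\sum_(j < n) (w j)%:C *: curve_derive (gamma j) 0).
Proof.
have dg j : curve_quotient (gamma j) 0 @ 0^' --> curve_derive (gamma j) 0.
  by apply: gamma_diff; rewrite in_itv /= oppr_lt0 heps.
apply: cvg_trans (cvg_expmx_comp (cvg_log_mean hw heps gamma_pos gamma0 dg)).
(* The power is rewritten as an exponential only where the mean is known to be positive definite,
   that is near 0, which is all the limit sees. *)
apply: near_eq_cvg; apply: filterS (near_mean_posdef hw heps gamma_pos gamma0 dg) => s pX.
by rewrite powmx_expmx.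
Qed.
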